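(* Let $0\le p<s\le n$ with $n\ge2$, and $q:=s-1-p$. Suppose the $n$ keys are distinct, the pivot $v$ is the $(p+1)$th smallest element of a uniformly random sample of $s$ of the keys, $v$ is placed in $x_1$, and the remaining $n-1$ keys occupy $x[2\colon n]$ in uniformly random order. Define $$E(n,s,p):=\frac{(p+1)(n+1)}{s+1}-1,\qquad T(n,s,p):=\frac{(p+1)(q+1)}{(s+1)(s+2)}\cdot\frac{(n+1)(n+2)}{n-1}-\frac{n}{n-1}.$$ Then the average numbers of swaps $T_A,T_B,T_C,T_D$ made by Schemes A, B, C, D (defined in the context), excluding the swaps of their final step, are $$T_A=\frac{\max\{n-3,0\}}{\max\{n-2,1\}}\,T(n,s,p)+\frac{1}{n-1}E(n,s,p),\qquad T_B=T_C=T(n,s,p),\qquad T_D=E(n,s,p).$$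
   Context: All schemes partition an array $x[1\colon n]$ ($n\ge2$) around the pivot value $v:=x_1$ (the value $v$ is stored, so later comparisons with $v$ use this value even if $x_1$ is moved). A ''swap'' or ''exchange'' $x_a\leftrightarrow x_b$ counts as one swap even if $a=b$. Scheme A: A1. Set $i:=1$, $p':=2$, $j:=n$, $q':=n-1$. If $v>x_j$, exchange $x_i\leftrightarrow x_j$ and set $p':=i$; else if $v<x_j$, set $q':=j$. A2. Increase $i$ by 1; then if $x_i<v$, repeat A2. A3. Decrease $j$ by 1; then if $x_j>v$, repeat A3. A4. If $i<j$, exchange $x_i\leftrightarrow x_j$ and return to A2. If $i=j$, increase $i$ by 1 and decrease $j$ by 1. A5 (final step). If $1<p'$, exchange $x_1\leftrightarrow x_j$; if $q'<n$, exchange $x_i\leftrightarrow x_n$. Scheme B: B1. Set $i:=1$, $j:=n+1$. B2. Increase $i$ by 1; then if $i\le n$ and $x_i<v$, repeat B2. B3. Decrease $j$ by 1; then if $x_j>v$, repeat B3. B4. If $i<j$, exchange $x_i\leftrightarrow x_j$ and return to B2. If $i=j$, increase $i$ by 1 and decrease $j$ by 1. B5 (final step). Exchange $x_1\leftrightarrow x_j$. Scheme C: C1. Set $i:=2$, $j:=n$. C2. If $i\le j$ and $x_i<v$, increase $i$ by 1 and repeat C2. C3. If $i<j$ and $x_j>v$, decrease $j$ by 1 and repeat C3. If $i\ge j$, set $j:=i-1$ and go to C5. C4. Exchange $x_i\leftrightarrow x_j$, increase $i$ by 1, decrease $j$ by 1, return to C2. C5 (final step). Exchange $x_1\leftrightarrow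 x_j$. Scheme D (Lomuto): D1. Set $i:=2$, $p':=1$. D2. If $i>n$, go to D4. D3. If $x_i<v$, increase $p'$ by 1 and exchange $x_{p'}\leftrightarrow x_i$. Increase $i$ by 1 and return to D2. D4 (final step). Exchange $x_1\leftrightarrow x_{p'}$. (The scheme-internal index variables are written $p',q'$ to avoid clashing with the sample parameters $p,q$.) *)

(* Defs.v *)
From HB Require Import structures.
From mathcomp Require Import all_boot all_order all_algebra all_fingroup.

Set Implicit Arguments.
Unset Strict Implicit.
Unset Printing Implicit Defensive.

Import Order.TTheory GRing.Theory Num.Theory.

Inductive label := Step1 | Step2 | Step3 | Step4 | Step5 | Done.

(* Arrays x[1:n] are functions nat -> K; the entries outside 1..n carry no
   meaning, and [swaps_made_on] below quantifies over all of them.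
   The variables [i j p' q'] are shared by the four schemes, a scheme
   leaving those it does not use at 0. *)
Record state (K : Type) := State {
  at_label : label;
  var_i : nat; var_j : nat; var_p' : nat; var_q' : nat;
  array : nat -> K;
  swap_count : nat
}.

Definition exchange (K : Type) (x : nat -> K) (a b : nat) : nat -> K :=
  fun k => if k == a then x b else if k == b then x a else x k.

(* [step n v st] executes once the step at which [st] stands, for an array of
   length [n] and the stored pivot value [v]. [final_step] is the label of the
   step whose swaps are not counted. *)
Record scheme (K : Type) := Scheme {
  step : nat -> K -> state K -> state K;
  final_step : label
}.

Definition stepA (d : Order.disp_t) (K : orderType d) (n : nat) (v : K)
    (st : state K) : state K :=
  let: State l i j p' q' x c := st in
  match l with
  | Step1 =>
      if (x n < v)%O then State Step2 1 n 1 (n - 1) (exchange x 1 n) c.+1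
      else if (v < x n)%O then State Step2 1 n 2 n x c
      else State Step2 1 n 2 (n - 1) x c
  | Step2 =>
      if (x i.+1 < v)%O then State Step2 i.+1 j p' q' x c
      else State Step3 i.+1 j p' q' x c
  | Step3 =>
      if (v < x j.-1)%O then State Step3 i j.-1 p' q' x c
      else State Step4 i j.-1 p' q' x c
  | Step4 =>
      if (i < j)%N then State Step2 i j p' q' (exchange x i j) c.+1
      else if i == j then State Step5 i.+1 j.-1 p' q' x c
      else State Step5 i j p' q' x c
  | Step5 =>
      let: (x1, c1) := if (1 < p')%N then (exchange x 1 j, c.+1) else (x, c) in
      let: (x2, c2) := if (q' < n)%N then (exchange x1 i n, c1.+1)
                       else (x1, c1) in
      State Done i j p' q' x2 c2
  | Done => st
  end.

Definition stepB (d : Order.disp_t) (K : orderType d) (n : nat) (v : K)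
    (st : state K) : state K :=
  let: State l i j p' q' x c := st in
  match l with
  | Step1 => State Step2 1 n.+1 p' q' x c
  | Step2 =>
      if (i.+1 <= n)%N && (x i.+1 < v)%O then State Step2 i.+1 j p' q' x c
      else State Step3 i.+1 j p' q' x c
  | Step3 =>
      if (v < x j.-1)%O then State Step3 i j.-1 p' q' x c
      else State Step4 i j.-1 p' q' x c
  | Step4 =>
      if (i < j)%N then State Step2 i j p' q' (exchange x i j) c.+1
      else if i == j then State Step5 i.+1 j.-1 p' q' x c
      else State Step5 i j p' q' x c
  | Step5 => State Done i j p' q' (exchange x 1 j) c.+1
  | Done => st
  end.

Definition stepC (d : Order.disp_t) (K : orderType d) (n : nat) (v : K)
    (st : state K) : state K :=
  let: State l i j p' q' x c := st in
  match l with
  | Step1 => State Step2 2 n p' q' x c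
  | Step2 =>
      if (i <= j)%N && (x i < v)%O then State Step2 i.+1 j p' q' x c
      else State Step3 i j p' q' x c
  | Step3 =>
      if (i < j)%N && (v < x j)%O then State Step3 i j.-1 p' q' x c
      else if (j <= i)%N then State Step5 i i.-1 p' q' x c
      else State Step4 i j p' q' x c
  | Step4 => State Step2 i.+1 j.-1 p' q' (exchange x i j) c.+1
  | Step5 => State Done i j p' q' (exchange x 1 j) c.+1
  | Done => st
  end.

Definition stepD (d : Order.disp_t) (K : orderType d) (n : nat) (v : K)
    (st : state K) : state K :=
  let: State l i j p' q' x c := st in
  match l with
  | Step1 => State Step2 2 j 1 q' x c
  | Step2 =>
      if (n < i)%N then State Step4 i j p' q' x c
      else State Step3 i j p' q' x c
  | Step3 =>
      if (x i < v)%O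
      then State Step2 i.+1 j p'.+1 q' (exchange x p'.+1 i) c.+1
      else State Step2 i.+1 j p' q' x c
  | Step4 => State Done i j p' q' (exchange x 1 p') c.+1
  | Step5 | Done => st
  end.

Definition schemeA (d : Order.disp_t) (K : orderType d) : scheme K :=
  Scheme (@stepA d K) Step5.
Definition schemeB (d : Order.disp_t) (K : orderType d) : scheme K :=
  Scheme (@stepB d K) Step5.
Definition schemeC (d : Order.disp_t) (K : orderType d) : scheme K :=
  Scheme (@stepC d K) Step5.
Definition schemeD (d : Order.disp_t) (K : orderType d) : scheme K :=
  Scheme (@stepD d K) Step4.

Definition initial_state (K : Type) (x : nat -> K) : state K :=
  State Step1 0 0 0 0 x 0.

(* Started on x[1:n], the scheme arrives at its final step having made exactly
   [c] swaps. The final step is entered at most once, so [c] is unique. *)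
Definition swaps_made (K : Type) (sch : scheme K) (n : nat) (x : nat -> K)
    (c : nat) : Prop :=
  exists m : nat,
    let st := iter m (step sch n (x 1)) (initial_state x) in
    at_label st = final_step sch /\ swap_count st = c.

Definition swaps_made_on (K : Type) (sch : scheme K) (a : seq K) (c : nat)
    : Prop :=
  forall x : nat -> K,
    [seq x k | k <- iota 1 (size a)] = a -> swaps_made sch (size a) x c.

Local Open Scope ring_scope.

Definition average (I : finType) (A : {set I}) (f : I -> rat) : rat :=
  (\sum_(i in A) f i) / #|A|%:R.

(* The [n] keys are [key k], k : 'I_n; a sample is a set of indices of keys,
   and a permutation [u] of the indices puts [key (u k)] in x_(k+1). *)
Definition samples (n s : nat) : {set {set 'I_n}} :=
  [set S : {set 'I_n} | #|S| == s].

Definition sorted_sample (d : Order.disp_t) (K : orderType d) (n : nat)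
    (key : 'I_n -> K) (S : {set 'I_n}) : seq K :=
  sort <=%O [seq key k | k in S].

Definition arranged (d : Order.disp_t) (K : orderType d) (n : nat)
    (key : 'I_n -> K) (u : 'S_n) : seq K :=
  [seq key (u k) | k : 'I_n].

(* x_1 is the (p+1)th smallest key of the sample [S]; the other keys are in
   any order in x[2:n]. *)
Definition arrangements (d : Order.disp_t) (K : orderType d) (n : nat)
    (key : 'I_n -> K) (p : nat) (S : {set 'I_n}) : {set 'S_n} :=
  [set u : 'S_n | onth (arranged key u) 0 == onth (sorted_sample key S) p].

(* [t] is the expected number of swaps made by [sch] before its final step, for
   a uniformly random sample [S] and, given [S], a uniformly random arrangement
   [u]; the scheme is required to reach its final step for all of them. *)
Definition average_swaps (d : Order.disp_t) (K : orderType d)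
    (sch : scheme K) (n s p : nat) (key : 'I_n -> K) (t : rat) : Prop :=
  exists N : 'S_n -> nat,
    (forall S u, S \in samples n s -> u \in arrangements key p S ->
       swaps_made_on sch (arranged key u) (N u)) /\
    average (samples n s)
      (fun S => average (arrangements key p S) (fun u => (N u)%:R)) = t.

Definition E_swaps (n s p : nat) : rat :=
  (p%:R + 1) * (n%:R + 1) / (s%:R + 1) - 1.

Definition T_swaps (n s p : nat) : rat :=
  let q := (s - 1 - p)%N in
  (p%:R + 1) * (q%:R + 1) / ((s%:R + 1) * (s%:R + 2)) *
    ((n%:R + 1) * (n%:R + 2) / (n%:R - 1)) - n%:R / (n%:R - 1).

(* Main.v *)
(** Call a key small if it is below the pivot [v], large if it is above, and
    let [m] be the number of small keys. Schemes B and C make one swap for each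
    large key among the first [m] positions of [x[2:n]], scheme D one swap for
    each small key, and scheme A behaves like scheme B on [x[2:n-1]] after one
    extra swap if [x_n] is small.
    Given [v], the order of the other keys is invariant under transpositions of
    positions, so a position is large with probability [(n-1-m)/(n-1)], and two
    positions are jointly of given kinds with the hypergeometric probability;
    hence the average is a combination of [m] and [m(n-1-m)/(n-1)].
    The pivot has [m] small keys for ['C(m, p) * 'C(n-1-m, q)] of the samples.
    The factors [m+1] and [n-m] are absorbed into these binomials, and the
    convolution identity for binomials then gives the averages over samples. *)

Require Import Defs.
From HB Require Import structures.
From mathcomp Require Import all_boot all_order all_algebra all_fingroup.
From mathcomp Require Import ring lra zify.

Set Implicit Arguments.
Unset Strict Implicit.
Unset Printing Implicit Defensive.

Import Order.TTheory GRing.Theory Num.Theory.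

(** * Misplaced entries of a bit pattern *)

(** A bit [true] stands for a small key; the prefix taken is where the small keys end up after
    partitioning. *)
Definition misplaced (t : bitseq) : nat := count negb (take (count id t) t).

Lemma misplaced_cons_true t : misplaced (true :: t) = misplaced t.
Proof. by []. Qed.

Lemma misplaced_rcons_false t : misplaced (rcons t false) = misplaced t.
Proof.
by rewrite /misplaced -cats1 count_cat addn0 takel_cat ?count_size.
Qed.

(** The final [true] lengthens the prefix by one, and the leading [false] fills the extra place.
    This is the effect of one swap. *)
Lemma misplaced_exchange t :
  misplaced (false :: rcons t true) = (misplaced t).+1.
Proof.
by rewrite /misplaced /= -cats1 count_cat addn1 /= takel_cat ?count_size.
Qed.

(** * Runs of the four schemes *)

Section Simulation.
Local Open Scope order_scope.
Variables (d : Order.disp_t) (K : orderType d).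
Implicit Types (x : nat -> K) (v : K) (st : state K).

(** [swaps_made] from an arbitrary state, as inductions along a run need; [c] includes the swaps
    already counted in [st]. *)
Definition arrives (f : state K -> state K) (l : label) st (c : nat) : Prop :=
  exists m, at_label (iter m f st) = l /\ swap_count (iter m f st) = c.

Lemma arrives_step f l st st' c :
  f st = st' -> arrives f l st' c -> arrives f l st c.
Proof. by move=> <- [m H]; exists m.+1; rewrite iterSr. Qed.

Lemma arrives_here f l st c :
  at_label st = l -> swap_count st = c -> arrives f l st c.
Proof. by exists 0. Qed.

Definition window x v a m : bitseq := [seq x k < v | k <- iota a m].

Lemma windowS x v a m : window x v a m.+1 = (x a < v) :: window x v a.+1 m.
Proof. by []. Qed.

Lemma windowSr x v a m :
  window x v a m.+1 = rcons (window x v a m) (x (a + m)%N < v).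
Proof. by rewrite /window -addn1 iotaD map_cat cats1. Qed.

Lemma window_exchange x v i j a m : (i < a)%N -> (a + m <= j)%N ->
  window (exchange x i j) v a m = window x v a m.
Proof.
move=> hi hj; apply/eq_in_map => k; rewrite mem_iota /exchange => hk.
by rewrite !ifN //; lia.
Qed.

(* Steps 2 to 4 of schemes A and B differ only in the guard [G] of step 2. *)
Definition crossing_pointers (f : state K -> state K) v (G : pred nat) :=
  [/\ forall i j p q x c, f (State Step2 i j p q x c) =
        if G i.+1 && (x i.+1 < v) then State Step2 i.+1 j p q x c
        else State Step3 i.+1 j p q x c,
      forall i j p q x c, f (State Step3 i j p q x c) =
        if v < x j.-1 then State Step3 i j.-1 p q x c
        else State Step4 i j.-1 p q x c
    & forall i j p q x c, f (State Step4 i j p q x c) =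
        if (i < j)%N then State Step2 i j p q (exchange x i j) c.+1
        else if i == j then State Step5 i.+1 j.-1 p q x c
        else State Step5 i j p q x c].

(* [x i] and [x j] are sentinels: the upward scan stops at [j] at the latest,
   the downward scan at [i]. *)
Lemma crossing_pointers_arrives f v G m : crossing_pointers f v G ->
  forall i j p q x c, j = (i + m).+1 ->
  (forall k, (k < j)%N -> G k) -> ~~ (G j && (x j < v)) -> ~~ (v < x i) ->
  (forall k, (i < k < j)%N -> x k != v) ->
  arrives f Step5 (State Step2 i j p q x c) (c + misplaced (window x v i.+1 m)).
Proof.
case=> f2 f3 f4; have [N] := ubnP m.
elim: N m => // N IH m mN i j p q x c jE Gj xj xi xne.
(* The downward scan, where [x i.+1] is already known to be large. *)
have down m' j' : (m' <= m)%N -> j' = (i + m').+1 -> ((0 < m')%N -> v < x i.+1) ->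
    arrives f Step5 (State Step3 i.+1 j' p q x c)
      (c + misplaced (window x v i.+1 m')).
  elim: m' j' => [|m' IHm] j' m'm j'E large.
    apply: arrives_step (f3 _ _ _ _ _ _) _.
    rewrite j'E addn0 /= (negbTE xi).
    apply: arrives_step (f4 _ _ _ _ _ _) _.
    rewrite ifN ?ifN; [|lia|lia].
    by apply: arrives_here; rewrite //= addn0.
  apply: arrives_step (f3 _ _ _ _ _ _) _.
  rewrite windowSr.
  have -> : j'.-1 = (i.+1 + m')%N by lia.
  case: ltP => [lt|le].
    rewrite lt_gtF // misplaced_rcons_false.
    by apply: IHm => [||_]; [lia|lia|apply: large].
  have lt : x (i.+1 + m')%N < v.
    by rewrite lt_neqAle le andbT; apply: xne; lia.
  (* A single remaining cell would be [x i.+1], which is large, so a small key is found only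
     strictly to its right. *)
  case: m' => [|m'] in IHm m'm j'E large le lt *.
    by move: lt; rewrite addn0 (lt_gtF (large isT)).
  apply: arrives_step (f4 _ _ _ _ _ _) _.
  rewrite ifT; last lia.
  (* The window runs from a large to a small key, so [misplaced_exchange] accounts for the swap. The
     interior is unchanged, and the exchanged entries become the new sentinels. *)
  rewrite windowS lt (lt_gtF (large isT))
    (@misplaced_exchange (window x v i.+2 m')) -(addSnnS c).
  rewrite -(@window_exchange x v i.+1 (i.+1 + m'.+1)) //; last lia.
  apply: IH => //; first lia.
  - lia.
  - by move=> k hk; apply: Gj; lia.
  - rewrite /exchange eqxx ifN; last lia.
    by rewrite (lt_gtF (large isT)) andbF.
  - by rewrite /exchange eqxx -leNgt ltW.
  - move=> k hk; rewrite /exchange !ifN; try lia.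
    by apply: xne; lia.
apply: arrives_step (f2 _ _ _ _ _ _) _.
case: m => [|m] in mN jE down *.
  rewrite addn0 in jE; rewrite -jE (negbTE xj) jE.
  by apply: down; lia.
rewrite Gj /=; last lia.
case: ltP => [lt|le].
  rewrite windowS lt misplaced_cons_true.
  apply: IH => //; first lia.
  - by rewrite -leNgt ltW.
  - by move=> k hk; apply: xne; lia.
apply: down => // _.
by rewrite lt_neqAle le andbT eq_sym xne //; lia.
Qed.

(** The upward scan is stopped by its guard at [n.+1], the downward scan by the pivot at position
    1. *)
Lemma schemeB_arrives n x : (0 < n)%N ->
  (forall k, (1 < k <= n)%N -> x k != x 1) ->
  swaps_made (schemeB K) n x (misplaced (window x (x 1) 2 n.-1)).
Proof.
move=> n0 xne; apply: arrives_step; first by [].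
apply: (@crossing_pointers_arrives _ _ (fun k => (k <= n)%N)) => //.
- by rewrite /=; lia.
- by rewrite ltnn.
- by rewrite ltxx.
Qed.

(** After the first step [x 1] is not large and [x n] is not small, so both are sentinels for the
    positions strictly between. The exchange, made when [x n] is small, leaves those positions
    untouched. *)
Lemma schemeA_arrives n x : (1 < n)%N ->
  (forall k, (1 < k <= n)%N -> x k != x 1) ->
  swaps_made (schemeA K) n x
    ((x n < x 1)%O + misplaced (window x (x 1) 2 n.-2)).
Proof.
move=> n1 xne.
have cp : crossing_pointers (stepA n (x 1)) (x 1) predT by [].
apply: arrives_step; first by [].
rewrite /=; case: ltP => [lt|le].
  rewrite -(@window_exchange x _ 1 n) //; last lia.
  apply: (crossing_pointers_arrives cp) => //.
  - lia.
  - by rewrite /exchange eqxx ifN ?ltxx //; lia.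
  - by rewrite /exchange eqxx lt_gtF.
  - move=> k hk; rewrite /exchange !ifN; try lia.
    by apply: xne; lia.
rewrite lt_neqAle le andbT eq_sym xne; last lia.
apply: (crossing_pointers_arrives cp) => //.
- lia.
- by rewrite ltNge le.
- by rewrite ltxx.
- by move=> k hk; apply: xne; lia.
Qed.

(** The induction is that for crossing pointers, with index tests in place of sentinels; the window
    now includes both pointers. *)
Lemma schemeC_loop n v m i j p q x c :
  (i + m)%N = j.+1 -> (forall k, (i <= k <= j)%N -> x k != v) ->
  arrives (stepC n v) Step5 (State Step2 i j p q x c)
    (c + misplaced (window x v i m)).
Proof.
have [N] := ubnP m.
elim: N m i j x c => // N IH m i j x c mN jE xne.
have down m' j' : (m' <= m)%N -> (i + m')%N = j'.+1 ->
    ((0 < m')%N -> v < x i) ->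
    arrives (stepC n v) Step5 (State Step3 i j' p q x c)
      (c + misplaced (window x v i m')).
  elim: m' j' => [|m' IHm] j' m'm j'E large.
    apply: arrives_step => //.
    rewrite [stepC _ _ _]/= ifN ?ifT; try lia.
    by apply: arrives_here; rewrite //= addn0.
  have j'E' : j' = (i + m')%N by lia.
  apply: arrives_step => //.
  rewrite [stepC _ _ _]/= j'E'.
  (* When the pointers meet, the one remaining key is large and contributes no swap. *)
  case: m' => [|m'] in IHm m'm j'E j'E' large *.
    rewrite addn0 ltnn leqnn /=; apply: arrives_here => //=.
    by rewrite windowS (lt_gtF (large isT)) addn0.
  have ij : (i < i + m'.+1)%N by lia.
  rewrite ij /= leqNgt ij /= windowSr.
  case: ltP => [lt|le].
    rewrite lt_gtF // misplaced_rcons_false.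
    by apply: IHm => [||_]; [lia|lia|apply: large].
  have lt : x (i + m'.+1)%N < v.
    by rewrite lt_neqAle le andbT; apply: xne; lia.
  apply: arrives_step => //.
  rewrite windowS lt (lt_gtF (large isT))
    (@misplaced_exchange (window x v i.+1 m')) -(addSnnS c).
  rewrite -(@window_exchange x v i (i + m'.+1)) //; last lia.
  apply: IH; [lia|lia|] => k hk; rewrite /exchange !ifN; try lia.
  by apply: xne; lia.
apply: arrives_step => //=.
case: m => [|m] in mN jE down *.
  rewrite leqNgt ifN; last lia.
  by apply: down; lia.
have ij : (i <= j)%N by lia.
rewrite ij /=.
case: ltP => [lt|le].
  rewrite windowS lt misplaced_cons_true.
  by apply: IH; [lia|lia|] => k hk; apply: xne; lia.
apply: down => // _.
by rewrite lt_neqAle le andbT eq_sym xne //; lia.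
Qed.

Lemma schemeC_arrives n x : (0 < n)%N ->
  (forall k, (1 < k <= n)%N -> x k != x 1) ->
  swaps_made (schemeC K) n x (misplaced (window x (x 1) 2 n.-1)).
Proof.
move=> n0 xne; apply: arrives_step; first by [].
by apply: schemeC_loop => //; lia.
Qed.

(** Since [p < i], an exchange affects no position beyond [i], so the keys still to be scanned keep
    their values. *)
Lemma schemeD_loop n v m i j p q x c : (i + m)%N = n.+1 -> (p < i)%N ->
  arrives (stepD n v) Step4 (State Step2 i j p q x c)
    (c + count id (window x v i m)).
Proof.
elim: m i p x c => [|m IH] i p x c iE pi.
  apply: arrives_step => //=; rewrite ifT; last lia.
  by apply: arrives_here; rewrite //= addn0.
apply: arrives_step => //=; rewrite ifN; last lia.
rewrite -/(window x v i.+1 m).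
apply: arrives_step => //=; case: ifP => _; last by apply: IH; lia.
rewrite addnA addn1.
have -> : window x v i.+1 m = window (exchange x p.+1 i) v i.+1 m.
  apply/eq_in_map => k; rewrite mem_iota /exchange => hk.
  by rewrite !ifN //; lia.
by apply: IH; lia.
Qed.

Lemma schemeD_arrives n x : (0 < n)%N ->
  swaps_made (schemeD K) n x (count id (window x (x 1) 2 n.-1)).
Proof.
move=> n0; apply: arrives_step; first by [].
by apply: schemeD_loop => //; lia.
Qed.

End Simulation.

(** * Prefix counts as sums over positions *)

Lemma count_take_enum n (b : 'I_n -> bool) m :
  count negb (take m [seq b k | k : 'I_n]) = \sum_(k < n) ((k < m) && ~~ b k).
Proof.
elim: n b m => [|n IH] b m.
  by rewrite big_ord0 /image_mem (size0nil (size_enum_ord 0)).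
rewrite /image_mem enum_ordSl big_ord_recl /=.
case: m => [|m] /=; first by rewrite big1.
by rewrite -map_comp -IH.
Qed.

Lemma sum_ltn n m : \sum_(k < n) (k < m) = minn m n.
Proof.
elim: n => [|n IH]; first by rewrite big_ord0 minn0.
by rewrite big_ord_recr /= IH; case: ltnP; lia.
Qed.

(** For the pattern of [x[2:n]], the last bit is the exchange in the first step of scheme A. *)
Definition swapsA (t : bitseq) : nat :=
  last false t + misplaced (take (size t).-1 t).

Lemma swapsA_rcons t b : swapsA (rcons t b) = b + misplaced t.
Proof. by rewrite /swapsA last_rcons size_rcons -cats1 take_size_cat. Qed.

(** * Averages over arrangements with a fixed pivot *)

Section FixedPivot.
Local Open Scope ring_scope.
Variables (n : nat) (t : 'I_n.+1).

Definition pivot_first : {set 'S_n.+1} :=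
  [set u : 'S_n.+1 | u ord0 == t].

(** Left multiplication by [tperm k l] swaps two positions and, as neither is the first, permutes
    [pivot_first]. *)
Lemma sum_pivot_first_tperm k l (F : 'S_n.+1 -> rat) :
  k != ord0 -> l != ord0 ->
  \sum_(u in pivot_first) F (tperm k l * u)%g = \sum_(u in pivot_first) F u.
Proof.
move=> k0 l0; rewrite [RHS](reindex_inj (mulgI (tperm k l))).
by apply: eq_bigl => u; rewrite !inE permM tpermD.
Qed.

Lemma sum_other_positions (f : 'I_n.+1 -> rat) u : u \in pivot_first ->
  \sum_(l | l != ord0) f (u l) = \sum_(i | i != t) f i.
Proof.
rewrite inE => /eqP ut; rewrite [RHS](reindex_inj (@perm_inj _ u)).
by apply: eq_bigl => l; rewrite -ut (inj_eq perm_inj).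
Qed.

(* The sum does not depend on [k], and it is evident once summed over [k]. *)
Lemma sum_one_position (f : 'I_n.+1 -> rat) k : k != ord0 ->
  n%:R * (\sum_(u in pivot_first) f (u k)) =
  #|pivot_first|%:R * \sum_(i | i != t) f i.
Proof.
move=> k0; transitivity (\sum_(l | l != ord0) \sum_(u in pivot_first) f (u l)).
  rewrite [RHS](eq_bigr (fun=> \sum_(u in pivot_first) f (u k))) => [|l l0].
    rewrite sumr_const mulr_natl; congr (_ *+ _).
    have := cardC1 (@ord0 n); rewrite card_ord /= => {1}<-.
    by apply: eq_card => i; rewrite !inE.
  rewrite -(@sum_pivot_first_tperm k l) //.
  by apply: eq_bigr => u _; rewrite permM tpermR.
rewrite exchange_big /= (eq_bigr (fun=> \sum_(i | i != t) f i)).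
  by rewrite sumr_const mulr_natl.
by move=> u; apply: sum_other_positions.
Qed.

(** With [l] fixed, the sum is the same for each of the [n.-1] choices of [k]. Summing over them
    runs [g] through all keys except the pivot and the one at [l]. *)
Lemma sum_two_positions (f g : 'I_n.+1 -> rat) k l :
  k != ord0 -> l != ord0 -> k != l ->
  n.-1%:R * (\sum_(u in pivot_first) f (u l) * g (u k)) =
  \sum_(u in pivot_first) f (u l) * (\sum_(i | i != t) g i - g (u l)).
Proof.
move=> k0 l0 kl; transitivity (\sum_(h | (h != ord0) && (h != l))
    \sum_(u in pivot_first) f (u l) * g (u h)).
  rewrite [RHS](eq_bigr (fun=> \sum_(u in pivot_first) f (u l) * g (u k))).
    rewrite sumr_const mulr_natl; congr (_ *+ _).
    have := cardC [set ord0; l]; rewrite cards2 eq_sym l0 card_ord => h.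
    have -> : n.-1 = #|[predC [set ord0; l]]| by lia.
    by apply: eq_card => i; rewrite !inE negb_or.
  move=> h /andP[h0 hl]; rewrite -(@sum_pivot_first_tperm k h) //.
  by apply: eq_bigr => u _; rewrite !permM tpermR tpermD.
rewrite exchange_big /=; apply: eq_bigr => u uA.
rewrite -mulr_sumr; congr (_ * _).
by rewrite -(sum_other_positions _ uA) [in RHS](bigD1 l) //= addrC addrK.
Qed.

Variable P : pred 'I_n.+1.
Hypothesis Pt : ~~ P t.

Let f i : rat := (P i)%:R.
Let g i : rat := (~~ P i)%:R.
Let M : rat := #|pivot_first|%:R.

Lemma sum_small : \sum_(i | i != t) f i = #|P|%:R.
Proof.
rewrite -sum1_card natr_sum [RHS]big_mkcond [RHS](bigD1 t) //=.
rewrite [t \in P](negbTE Pt) add0r.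
by apply: eq_bigr => i _; rewrite /f -topredE /=; case: (P i).
Qed.

Lemma sum_large : \sum_(i | i != t) g i = n%:R - #|P|%:R.
Proof.
rewrite -sum_small; apply/eqP; rewrite eq_sym subr_eq -big_split /=.
rewrite (eq_bigr (fun=> 1)) => [|i _]; last by rewrite /f /g; case: (P i).
rewrite sumr_const; apply/eqP; congr _%:R.
have := cardC1 t; rewrite card_ord /= => {1}<-.
by apply: eq_card => i; rewrite !inE.
Qed.

Lemma card_small_le : (#|P| <= n)%N.
Proof.
have := max_card [predU1 t & P]; rewrite cardU1 [t \in P](negbTE Pt) card_ord.
by rewrite add1n.
Qed.

Definition small_positions (u : 'S_n.+1) : bitseq :=
  [seq P (u (lift ord0 k)) | k : 'I_n].

Lemma count_small_positions u : u \in pivot_first ->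
  count id (small_positions u) = #|P|.
Proof.
move=> uA; apply/eqP; rewrite -(eqr_nat rat) -sum_small.
rewrite -(sum_other_positions _ uA) count_map -sum1_count natr_sum.
rewrite [X in _ == X]big_mkcond big_ord_recl /= add0r.
rewrite big_enum_cond /= big_mkcond /=; apply/eqP/eq_bigr => i _.
by rewrite /f; case: (P _).
Qed.

Lemma sum_count_small_positions :
  \sum_(u in pivot_first) (count id (small_positions u))%:R = M * #|P|%:R.
Proof.
rewrite (eq_bigr (fun=> #|P|%:R)) => [|u uA]; last by rewrite count_small_positions.
by rewrite sumr_const mulr_natl.
Qed.

Hypothesis n0 : (0 < n)%N.

(** The prefix length is [#|P|] for every arrangement, so linearity reduces the sum to one position
    at a time. *)
Lemma sum_misplaced_small_positions :
  \sum_(u in pivot_first) (misplaced (small_positions u))%:R =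
  M * (#|P|%:R * (n%:R - #|P|%:R) / n%:R).
Proof.
transitivity (\sum_(u in pivot_first) \sum_(k < n)
    ((k < #|P|)%N)%:R * g (u (lift ord0 k))).
  apply: eq_bigr => u uA.
  rewrite /misplaced count_small_positions // count_take_enum natr_sum.
  by apply: eq_bigr => k _; rewrite -mulnb natrM.
rewrite exchange_big /=.
have nz : n%:R != 0 :> rat by rewrite pnatr_eq0 -lt0n.
rewrite (eq_bigr (fun k : 'I_n => (k < #|P|)%N%:R * (M * (n%:R - #|P|%:R) / n%:R))).
  rewrite -mulr_suml -natr_sum sum_ltn (minn_idPl card_small_le).
  by field.
move=> k _; rewrite -mulr_sumr; congr (_ * _); apply: (mulfI nz).
by rewrite sum_one_position // sum_large -/M; field.
Qed.

End FixedPivot.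

(** * Scheme A with a fixed pivot *)

Section FixedPivotA.
Local Open Scope ring_scope.
Variables (n : nat) (t : 'I_n.+2) (P : pred 'I_n.+2).
Hypothesis Pt : ~~ P t.

Let f i : rat := (P i)%:R.
Let g i : rat := (~~ P i)%:R.
Let M : rat := #|pivot_first t|%:R.
Let m := #|P|.

(** The prefix length depends on the last key: a small one leaves only [m.-1] small keys in the
    interior. *)
Lemma swapsA_small_positions u : u \in pivot_first t ->
  (swapsA (small_positions P u))%:R = f (u ord_max) +
    \sum_(k < n)
      (f (u ord_max) * g (u (lift ord0 (widen_ord (leqnSn n) k)))
         * ((k < m.-1)%N)%:R +
       g (u ord_max) * g (u (lift ord0 (widen_ord (leqnSn n) k)))
         * ((k < m)%N)%:R) :> rat.
Proof.
move=> uA; have := count_small_positions Pt uA; rewrite -/m.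
have lm : lift ord0 (@ord_max n) = ord_max by apply/val_inj.
rewrite /small_positions /image_mem enum_ordSr map_rcons swapsA_rcons lm.
rewrite -map_comp /= -cats1 count_cat /= addn0 /misplaced => cE.
rewrite natrD; congr (_ + _); rewrite count_take_enum natr_sum.
apply: eq_bigr => k _; rewrite /f /g /=; move: cE.
case: (P (u ord_max)) => /=; set c := count _ _ => cE.
  have -> : c = m.-1 by lia.
  by rewrite mul1r !mul0r addr0 mulrC -natrM mulnb.
have -> : c = m by lia.
by rewrite mul1r !mul0r add0r mulrC -natrM mulnb.
Qed.

Lemma sum_swapsA_small_positions :
  \sum_(u in pivot_first t) (swapsA (small_positions P u))%:R =
  M * (Num.max (n%:R - 1) 0 / Num.max n%:R 1 *
         (m%:R * (n.+1%:R - m%:R) / n.+1%:R) + m%:R / n.+1%:R).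
Proof.
rewrite (eq_bigr _ swapsA_small_positions) big_split /= exchange_big /=.
have nz : n.+1%:R != 0 :> rat by rewrite pnatr_eq0.
have -> : \sum_(u in pivot_first t) f (u ord_max) = M * m%:R / n.+1%:R.
  apply: (mulfI nz); rewrite sum_one_position // sum_small // -/M -/m.
  by rewrite mulrCA mulfV ?mulr1.
(* An array of two keys has no interior, and the coefficient with [Num.max] is then 0. *)
case: (posnP n) => [n0|n0].
  rewrite big1 => [|k _]; last by have := ltn_ord k; lia.
  have -> : Num.max (n%:R - 1) 0 = 0 :> rat by apply/max_idPr; rewrite n0; lra.
  by rewrite !mul0r add0r addr0 mulrA.
have nz' : n%:R != 0 :> rat by rewrite pnatr_eq0 -lt0n.
(* These are the hypergeometric laws of the pairs small-large and large-large. *)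
have pair k : k != ord0 -> k != ord_max ->
    \sum_(u in pivot_first t) f (u ord_max) * g (u k) =
      M * m%:R * (n.+1%:R - m%:R) / (n.+1%:R * n%:R) /\
    \sum_(u in pivot_first t) g (u ord_max) * g (u k) =
      M * (n.+1%:R - m%:R) * (n.+1%:R - m%:R - 1) / (n.+1%:R * n%:R).
  move=> k0 kmax; have nz2 := mulf_neq0 nz nz'.
  have cancel a b : a / (n.+1%:R * n%:R) = b <-> a = n.+1%:R * n%:R * b :> rat.
    by split=> [<-|->]; [rewrite mulrC divfK|rewrite mulrC mulKf].
  have two := @sum_two_positions n.+1 t; rewrite /= in two.
  split; apply/esym/cancel; rewrite -[RHS]mulrA two // sum_large // -/m.
    (* At one key [f * g = 0]; in the second case [g * g = g] produces the [- 1]. *)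
    rewrite (eq_bigr (fun u : 'S_n.+2 => (n.+1%:R - m%:R) * f (u ord_max))).
      rewrite -mulr_sumr mulrCA sum_one_position // sum_small // -/M -/m; ring.
    by move=> u _; rewrite /f /g; case: (P _); rewrite /=; ring.
  rewrite (eq_bigr (fun u : 'S_n.+2 => (n.+1%:R - m%:R - 1) * g (u ord_max))).
    rewrite -mulr_sumr mulrCA sum_one_position // sum_large // -/M -/m; ring.
  by move=> u _; rewrite /f /g; case: (P _); rewrite /=; ring.
rewrite (eq_bigr (fun k : 'I_n =>
    M * m%:R * (n.+1%:R - m%:R) / (n.+1%:R * n%:R) * ((k < m.-1)%N)%:R +
    M * (n.+1%:R - m%:R) * (n.+1%:R - m%:R - 1) / (n.+1%:R * n%:R)
      * ((k < m)%N)%:R)); last first.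
  move=> k _; rewrite big_split /= -!mulr_suml.
  by have [|| -> ->] // := pair (lift ord0 (widen_ord (leqnSn n) k));
    rewrite -?val_eqE //= /bump /=; have := ltn_ord k; lia.
rewrite big_split /= -!mulr_sumr -!natr_sum !sum_ltn.
have mn : (m <= n.+1)%N by apply: card_small_le Pt.
have -> : Num.max n%:R 1 = n%:R :> rat by apply/max_idPl; rewrite ler1n.
have -> : Num.max (n%:R - 1) 0 = n%:R - 1 :> rat.
  by apply/max_idPl; rewrite subr_ge0 ler1n.
rewrite (minn_idPl (_ : m.-1 <= n)%N); last lia.
(* The case [m = 0] is separate because [m.-1] is truncated there. *)
have [m0|m0] := posnP m; first by rewrite m0 min0n /= !(mulr0, mul0r, addr0).
have -> : m.-1%:R = m%:R - 1 :> rat by rewrite -subn1 natrB.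
(* For [m = n.+1] the minimum with [n] is not [m], but the factor [n.+1 - m] vanishes. *)
have [mn'|mn'] := leqP m n.
  by rewrite -(natr1 n); field; rewrite natr1 nz nz'.
have -> : m = n.+1 by lia.
by rewrite subrr !(mulr0, mul0r, addr0, add0r) mulrA.
Qed.

End FixedPivotA.

(** * Convolution of binomials *)

(** The term at [m] counts the subsets of [N.+1] points, of size [p + q.+1], whose element with
    exactly [p] members below it is [m]. The induction uses Pascal's rule on the second factor. *)
Lemma sum_bin_bin N p q :
  \sum_(m < N.+1) 'C(m, p) * 'C(N - m, q) = 'C(N.+1, p + q.+1).
Proof.
elim: N q => [|N IH] q.
  rewrite big_ord_recl big_ord0 addn0 subn0.
  by case: p q => [|p] [|q]; rewrite ?addn0 ?bin0n //= bin_small //; lia.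
rewrite big_ord_recr /= subnn.
case: q => [|q].
  rewrite (eq_bigr (fun m : 'I_N.+1 => 'C(m, p) * 'C(N - m, 0))).
    by rewrite IH bin0 muln1 addn1 binS.
  by move=> m _; rewrite !bin0.
rewrite bin0n muln0 addn0.
rewrite (eq_bigr (fun m : 'I_N.+1 =>
  'C(m, p) * 'C(N - m, q.+1) + 'C(m, p) * 'C(N - m, q))).
  by rewrite big_split /= !IH [in RHS]addnS binS -addnS.
by move=> m _; rewrite subSn ?binS ?mulnDr // -ltnS.
Qed.

(** * Samples with a given pivot *)

Section Samples.
Variables (d : Order.disp_t) (K : orderType d) (n : nat) (key : 'I_n.+1 -> K).
Hypothesis key_inj : injective key.
Implicit Types (S : {set 'I_n.+1}) (t : 'I_n.+1).

Definition smaller t : pred 'I_n.+1 := fun i => (key i < key t)%O.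

Lemma smaller_irr t : ~~ smaller t t.
Proof. by rewrite /smaller ltxx. Qed.

(** In a strictly sorted sequence the index of a member is the number of members below it, and
    sorting preserves that number. *)
Lemma onth_sorted_sample p S t :
  (onth (sorted_sample key S) p == Some (key t)) =
  (t \in S) && (#|[set i in S | smaller t i]| == p).
Proof.
set srt := sorted_sample key S.
have srtP : sorted <%O srt.
  by rewrite sort_lt_sorted map_inj_uniq ?enum_uniq.
have cnt : count (< key t)%O srt = #|[set i in S | smaller t i]|.
  rewrite count_sort count_map -size_filter cardE; congr size.
  rewrite /enum_mem -filter_predI; apply: eq_filter => i /=.
  by rewrite !inE andbC.
have mem : (key t \in srt) = (t \in S).
  by rewrite mem_sort mem_map // mem_enum.
apply/eqP/andP => [op|[tS /eqP cp]].
  have := op; move/(onth_nth (key t)) => np.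
  have lt : p < size srt by rewrite -onthTE op.
  rewrite -mem -cnt -np mem_nth //; split => //.
  by rewrite count_lt_nth.
rewrite -mem in tS.
have := count_lt_nth (key t) srtP (i := index (key t) srt).
rewrite index_mem => /(_ tS); rewrite nth_index // cnt cp => ->.
by rewrite (onthE srt) (nth_map (key t)) ?index_mem // nth_index.
Qed.

(** Such a sample is [t] with [p] keys from below ([L]) and [s - 1 - p] from above ([U]); [h] sends
    it to this pair of subsets, bijectively. *)
Lemma card_samples_with_pivot s p t : p < s ->
  #|[set S in samples n.+1 s | onth (sorted_sample key S) p == Some (key t)]| =
  'C(#|smaller t|, p) * 'C(n - #|smaller t|, s - 1 - p).
Proof.
move=> ps; set L := [set i | smaller t i]; set U := [set i | smaller i t].
have cL : #|L| = #|smaller t| by rewrite cardsE.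
have tri i : [|| smaller t i, i == t | smaller i t].
  by rewrite /smaller; case: ltgtP; rewrite ?orbT // => /key_inj ->; rewrite eqxx.
have LU : [disjoint L & U].
  by rewrite -setI_eq0; apply/eqP/setP => i; rewrite !inE /smaller; case: ltgtP.
have tL : t \notin L by rewrite inE smaller_irr.
have tU : t \notin U by rewrite inE smaller_irr.
have cU : #|U| = n - #|smaller t|.
  have := cardsC (t |: (L :|: U)).
  have -> : ~: (t |: (L :|: U)) = set0.
    by apply/setP => i; rewrite !inE; have := tri i; case: eqP; rewrite ?orbT //=;
      case: smaller => //= _ ->.
  rewrite cards0 addn0 card_ord cardsU1 inE negb_or tL tU cardsU.
  by move: LU; rewrite -setI_eq0 => /eqP ->; rewrite cards0; lia.
rewrite -cU -cL -!cards_draws -cardsX.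
pose h S := (S :&: L, S :&: U).
rewrite -(card_in_imset (f := h)); last first.
  move=> S S'; rewrite !inE !onth_sorted_sample.
  move=> /andP[_ /andP[tS _]] /andP[_ /andP[tS' _]] [eL eU].
  apply/setP => i; have /setP/(_ i) := eL; have /setP/(_ i) := eU.
  rewrite !inE; have := tri i; case: eqP => [->|_]; first by rewrite tS tS'.
  by case: smaller => //=; case: smaller => //=; rewrite ?andbT.
congr #|pred_of_set _|; apply/setP => -[A B]; rewrite !inE /=.
apply/imsetP/andP => [[S]|[/andP[AL /eqP cA] /andP[BU /eqP cB]]].
  rewrite !inE onth_sorted_sample => /and3P[/eqP cS tS /eqP cp] [-> ->].
  have SL : #|S :&: L| = p.
    by rewrite -cp; apply: eq_card => i; rewrite !inE.
  rewrite !subsetIr SL eqxx; split=> //=; apply/eqP.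
  have SE : S = t |: (S :&: L :|: S :&: U).
    apply/setP => i; rewrite !inE; have := tri i.
    case: eqP => [->|_]; first by rewrite tS.
    by case: (smaller t i); case: (smaller i t) => //= _; rewrite ?andbT ?andbF ?orbF ?orbb.
  move: cS; rewrite {1}SE cardsU1 !inE (negbTE (smaller_irr t)) !andbF /=.
  have : [disjoint S :&: L & S :&: U].
    by apply: disjointWl (subsetIr _ _) _; apply: disjointWr (subsetIr _ _) _.
  by rewrite cardsU -setI_eq0 => /eqP ->; rewrite cards0 SL => <-;
    rewrite subn0 subn1 add1n /= addKn.
have AB : [disjoint A & B] by apply: disjointWl AL _; apply: disjointWr BU _.
have tA : t \notin A by apply: contra tL; apply: (subsetP AL).
have tB : t \notin B by apply: contra tU; apply: (subsetP BU).
have hL : (t |: (A :|: B)) :&: L = A.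
  apply/setP => i; rewrite in_setI in_setU1 in_setU.
  have [iA|iA] := boolP (i \in A); first by rewrite (subsetP AL) // orbT.
  apply/negP => /andP[/orP[/eqP->|/= iB] iL]; first by rewrite iL in tL.
  by have := disjointFr LU iL; rewrite (subsetP BU).
have hU : (t |: (A :|: B)) :&: U = B.
  apply/setP => i; rewrite in_setI in_setU1 in_setU.
  have [iB|iB] := boolP (i \in B); first by rewrite (subsetP BU) // !orbT.
  apply/negP => /andP[/orP[/eqP->|iA] iU]; first by rewrite iU in tU.
  by rewrite orbF in iA; have := disjointFl LU iU; rewrite (subsetP AL).
exists (t |: (A :|: B)); last by rewrite /h hL hU.
rewrite !inE onth_sorted_sample !inE eqxx /= cardsU1 inE negb_or tA tB cardsU.
move: AB; rewrite -setI_eq0 => /eqP ->; rewrite cards0 cA cB.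
apply/andP; split; first by apply/eqP; lia.
rewrite -[in X in _ == X]cA -[in X in _ == X]hL; apply/eqP/eq_card => i.
by rewrite !inE.
Qed.

Local Open Scope ring_scope.

Lemma arrangements_pivot p S t :
  onth (sorted_sample key S) p = Some (key t) ->
  arrangements key p S = pivot_first t.
Proof.
move=> op; apply/setP => u; rewrite !inE op /arranged /image_mem enum_ordSl /=.
by apply/eqP/eqP => [[/key_inj]|->].
Qed.

(** Distinct keys have distinct ranks, which lets a sum over pivots be reindexed by the number [m]
    of small keys. *)
Lemma card_smaller_inj : injective (fun t => #|smaller t|).
Proof.
move=> t t' e; apply: key_inj; apply/eqP; apply: contra_eqT e.
wlog lt : t t' / (key t < key t')%O => [H|].
  case: ltgtP => // lt _; last by rewrite eq_sym; apply: H => //; rewrite lt_eqF.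
  by apply: H => //; rewrite lt_eqF.
move=> _; rewrite neq_ltn; apply/orP; left; apply: proper_card.
apply/properP; split.
  by apply/subsetP => i; rewrite -!topredE /= => /lt_trans; apply.
by exists t; rewrite -topredE /= ?smaller_irr.
Qed.

Lemma average_by_pivot s p (N : 'S_n.+1 -> nat) (g : nat -> rat) :
  (p < s)%N ->
  (forall t, \sum_(u in pivot_first t) (N u)%:R =
             #|pivot_first t|%:R * g #|smaller t|) ->
  average (samples n.+1 s)
    (fun S => average (arrangements key p S) (fun u => (N u)%:R)) =
  (\sum_(m < n.+1) g m * ('C(m, p) * 'C(n - m, s - 1 - p))%N%:R)
    / 'C(n.+1, s)%:R.
Proof.
move=> ps gE; rewrite {1}/average card_draws card_ord; congr (_ / _).
(* Each sample has exactly one pivot, so its inner average is a one-term sum over [t]; the two sums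
   can then be exchanged. *)
transitivity (\sum_(S in samples n.+1 s)
    \sum_(t | onth (sorted_sample key S) p == Some (key t)) g #|smaller t|).
  apply: eq_bigr => S; rewrite inE => /eqP cS.
  have : exists t, onth (sorted_sample key S) p = Some (key t).
    have : onth (sorted_sample key S) p by rewrite onthTE size_sort size_map -cardE cS.
    case e : (onth _ p) => [y|] // _.
    have : y \in sorted_sample key S by apply/onthP; exists p.
    by rewrite mem_sort => /mapP[t _ ->]; exists t.
  move=> [t ot]; rewrite (arrangements_pivot ot) /average gE (big_pred1 t).
    rewrite mulrC mulKf // pnatr_eq0 -lt0n; apply/card_gt0P.
    by exists (tperm ord0 t); rewrite inE tpermL.
  by move=> t' /=; rewrite ot; apply/eqP/eqP => [[/key_inj]|->].
rewrite (exchange_big_dep predT) //=.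
have rk t : (#|smaller t| < n.+1)%N by rewrite ltnS (card_small_le (smaller_irr t)).
rewrite [RHS](reindex_inj (h := fun t => Ordinal (rk t))) /=; last first.
  by move=> t t' [/card_smaller_inj].
apply: eq_bigr => t _; rewrite -card_samples_with_pivot // mulr_natr.
by rewrite -sumr_const; apply: eq_bigl => S; rewrite !inE.
Qed.

End Samples.

(** * Averages over samples *)

Section AverageSwaps.
Local Open Scope ring_scope.
Variables (d : Order.disp_t) (K : orderType d) (n : nat) (key : 'I_n.+2 -> K).
Hypothesis key_inj : injective key.

Definition smalls (u : 'S_n.+2) : bitseq :=
  small_positions (smaller key (u ord0)) u.

Lemma window_arranged u x :
  [seq x k | k <- iota 1 (size (arranged key u))] = arranged key u ->
  window x (x 1%N) 2 n.+1 = smalls u /\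
  (forall k, (1 < k <= n.+2)%N -> x k != x 1%N).
Proof.
rewrite {1}/arranged size_map size_enum_ord.
rewrite /arranged /image_mem enum_ordSl /= -map_comp => -[x1 xE].
split.
  transitivity [seq (y < x 1%N)%O | y <- [seq x k | k <- iota 2 n.+1]].
    by rewrite -map_comp.
  by rewrite [[seq x k | k <- iota 2 n.+1]]xE -map_comp x1.
move=> k hk; have : x k \in [seq x k | k <- iota 2 n.+1].
  by apply: map_f; rewrite mem_iota; lia.
rewrite [[seq x k | k <- iota 2 n.+1]]xE => /mapP[i _ ->]; rewrite x1 /=.
by rewrite (inj_eq key_inj) (inj_eq perm_inj).
Qed.

(** [E_swaps] is the mean of [m] and [T_swaps] that of [m(n+1-m)/(n+1)] for arrays of length [n.+2],
    so linearity handles all four schemes at once. *)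
Lemma average_swapsI (sch : scheme K) s p (count_swaps : bitseq -> nat)
    (a b : rat) : (p < s)%N -> (s <= n.+2)%N ->
  (forall x, (forall k, (1 < k <= n.+2)%N -> x k != x 1%N) ->
     swaps_made sch n.+2 x (count_swaps (window x (x 1%N) 2 n.+1))) ->
  (forall t (m := #|smaller key t|),
     \sum_(u in pivot_first t)
        (count_swaps (small_positions (smaller key t) u))%:R =
     #|pivot_first t|%:R *
       (a * (m%:R * (n.+1%:R - m%:R) / n.+1%:R) + b * m%:R)) ->
  average_swaps sch s p key (a * T_swaps n.+2 s p + b * E_swaps n.+2 s p).
Proof.
move=> ps sn made sumE; exists (fun u => count_swaps (smalls u)); split.
  move=> S u _ _ x xE; have [wE xne] := window_arranged xE.
  by rewrite -wE size_map size_enum_ord; apply: made.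
pose g m : rat := a * (m%:R * (n.+1%:R - m%:R) / n.+1%:R) + b * m%:R.
rewrite (average_by_pivot key_inj (g := g) ps); last first.
  move=> t; rewrite -sumE; apply: eq_bigr => u; rewrite inE => /eqP ut.
  by rewrite /smalls ut.
set q := (s - 1 - p)%N.
have sE : s = (p + q.+1)%N by rewrite /q; lia.
pose w m : rat := ('C(m, p) * 'C(n.+1 - m, q))%N%:R.
have W0 : \sum_(m < n.+2) w m = 'C(n.+2, s)%:R.
  by rewrite -natr_sum sum_bin_bin -sE.
(* The factor [m.+1] raises both indices of ['C(m, p)]; the term at 0 of the shifted convolution
   vanishes. *)
have W1 : \sum_(m < n.+2) m.+1%:R * w m = p.+1%:R * 'C(n.+3, s.+1)%:R.
  rewrite sE -addSn -sum_bin_bin big_ord_recl mul0n add0n natr_sum mulr_sumr.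
  apply: eq_bigr => m _; rewrite /w !natrM !mulrA -!natrM.
  by rewrite (mul_bin_diag m.+1) /= subSS.
(* Both binomials absorb a factor here, and both end terms of the longer convolution vanish. *)
have W2 : \sum_(m < n.+2) m.+1%:R * (n.+2 - m)%N%:R * w m =
    p.+1%:R * q.+1%:R * 'C(n.+4, s.+2)%:R.
  rewrite sE -addnS -addSn -sum_bin_bin big_ord_recl mul0n add0n.
  rewrite [in RHS]big_ord_recr /= /bump /= add1n subnn bin0n muln0 addn0 natr_sum mulr_sumr.
  apply: eq_bigr => m _; rewrite /w !natrM.
  have e1 := mul_bin_diag m.+1 p; have e2 := mul_bin_diag (n.+2 - m) q.
  have e3 : ((n.+2 - m).-1 = n.+1 - m)%N by lia.
  rewrite /= e3 in e1 e2.
  transitivity ((m.+1 * 'C(m, p))%N%:R * ((n.+2 - m) * 'C(n.+1 - m, q))%N%:R : rat).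
    by rewrite !natrM; ring.
  by rewrite e1 e2 !natrM; ring.
have c0 : 'C(n.+2, s)%:R != 0 :> rat by rewrite pnatr_eq0 -lt0n bin_gt0.
have B1 : 'C(n.+3, s.+1)%:R = n.+3%:R / s.+1%:R * 'C(n.+2, s)%:R :> rat.
  apply: (mulfI (_ : s.+1%:R != 0)); first by rewrite pnatr_eq0.
  rewrite -natrM -mul_bin_diag natrM mulrA; congr (_ * _).
  by rewrite mulrC divfK // pnatr_eq0.
have B2 : 'C(n.+4, s.+2)%:R = n.+4%:R / s.+2%:R * 'C(n.+3, s.+1)%:R :> rat.
  apply: (mulfI (_ : s.+2%:R != 0)); first by rewrite pnatr_eq0.
  rewrite -natrM -mul_bin_diag natrM mulrA; congr (_ * _).
  by rewrite mulrC divfK // pnatr_eq0.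
(* This uses [m(n+1-m) = (m+1)(n+2-m) - (n+2)] and [m = (m+1) - 1]. *)
have -> : \sum_(m < n.+2) g m * w m =
    a / n.+1%:R * (\sum_(m < n.+2) m.+1%:R * (n.+2 - m)%N%:R * w m)
    + b * (\sum_(m < n.+2) m.+1%:R * w m)
    - (a * n.+2%:R / n.+1%:R + b) * (\sum_(m < n.+2) w m).
  rewrite !mulr_sumr -big_split /= -sumrB.
  apply: eq_bigr => m _; rewrite /g natrB; last by have := ltn_ord m; lia.
  by rewrite -!natr1; field; rewrite natr1 pnatr_eq0.
rewrite W0 W1 W2 B2 B1 /T_swaps /E_swaps -/q.
rewrite -!natr1.
have s0 : 0 <= s%:R :> rat by [].
have r0 : 0 <= n%:R :> rat by [].
field.
rewrite c0; apply/and4P; split => //; apply/lt0r_neq0; lra.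
Qed.
End AverageSwaps.

(** * The averages of the four schemes *)

Local Open Scope ring_scope.

Theorem theorem1 (d : Order.disp_t) (K : orderType d) (n s p : nat)
    (key : 'I_n -> K) :
  (2 <= n)%N -> (p < s)%N -> (s <= n)%N -> injective key ->
  [/\ average_swaps (schemeA K) s p key
        (Num.max (n%:R - 3) 0 / Num.max (n%:R - 2) 1 * T_swaps n s p
         + 1 / (n%:R - 1) * E_swaps n s p),
      average_swaps (schemeB K) s p key (T_swaps n s p),
      average_swaps (schemeC K) s p key (T_swaps n s p) &
      average_swaps (schemeD K) s p key (E_swaps n s p)].
Proof.
case: n key => [|[|n]] key // _ ps sn key_inj.
have TE : T_swaps n.+2 s p = 1 * T_swaps n.+2 s p + 0 * E_swaps n.+2 s p.
  by rewrite mul1r mul0r addr0.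
split.
- apply: (average_swapsI key_inj (count_swaps := swapsA)) => // [x xne|t m].
    have := schemeA_arrives (isT : 1 < n.+2)%N xne.
    by rewrite windowSr swapsA_rcons.
  rewrite sum_swapsA_small_positions ?smaller_irr // -/m.
  have -> : n.+2%:R - 3 = n%:R - 1 :> rat by rewrite -addn2 natrD; ring.
  have -> : n.+2%:R - 2 = n%:R :> rat by rewrite -addn2 natrD; ring.
  have -> : n.+2%:R - 1 = n.+1%:R :> rat by rewrite -natr1; ring.
  by rewrite mul1r [_^-1 * _]mulrC.
- rewrite TE; apply: (average_swapsI key_inj (count_swaps := misplaced)) => //.
    by move=> x; apply: schemeB_arrives.
  move=> t m; rewrite sum_misplaced_small_positions ?smaller_irr // -/m.
  by rewrite mul1r mul0r addr0.
- rewrite TE; apply: (average_swapsI key_inj (count_swaps := misplaced)) => //.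
    by move=> x; apply: schemeC_arrives.
  move=> t m; rewrite sum_misplaced_small_positions ?smaller_irr // -/m.
  by rewrite mul1r mul0r addr0.
have -> : E_swaps n.+2 s p = 0 * T_swaps n.+2 s p + 1 * E_swaps n.+2 s p.
  by rewrite mul1r mul0r add0r.
apply: (average_swapsI key_inj (count_swaps := count id)) => //.
  by move=> x _; apply: schemeD_arrives.
move=> t m; rewrite sum_count_small_positions ?smaller_irr // -/m.
by rewrite mul1r mul0r add0r.
Qed.
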